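(* Let $\{X_n\}_{n\ge0}$ be an ergodic Markov chain on a state space $\mathcal{X}$ with stationary distribution $\pi$, let $h:\mathcal{X}\to\mathbb{R}$ be measurable with $\pi(h)=\int_{\mathcal X} h\,d\pi$ finite, and let $e_n=\frac1n\sum_{i=1}^n h(X_i)$. Let $\alpha\in(0,1)$ and let $(a_n)$, $(b_n)$ be sequences of real numbers such that, when the chain is started in stationarity ($X_0\sim\pi$), $$\liminf_{n\to\infty}P\big(a_n<\pi(h)-e_n<b_n\big)\ \ge\ 1-\alpha.$$ Then for any $c>0$ and $0<r<1$, and for $\pi$-a.e. initial state $x\in\mathcal{X}$, when the chain is started at $X_0=x$, $$\liminf_{n\to\infty}P\big(a_n-cn^{-r}<\pi(h)-e_n<b_n+cn^{-r}\big)\ \ge\ 1-\alpha.$$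
   Context: $\mathcal{X}$ is a general measurable state space and the chain is time-homogeneous with $n$-step transition kernels $P^n(x,\cdot)$. Ergodic means that $\pi$ is a stationary probability distribution and $\lim_{n\to\infty}\|P^n(x,\cdot)-\pi(\cdot)\|=0$ for $\pi$-a.e. $x\in\mathcal{X}$, where $\|\mu-\nu\|=\sup_A|\mu(A)-\nu(A)|$ is total variation distance. That $\pi(h)$ is finite means that $h$ is $\pi$-integrable. *)

(* Defs.v *)
From HB Require Import structures.
From mathcomp Require Import all_boot all_order all_algebra.
From mathcomp Require Import all_classical all_reals all_analysis.

Set Implicit Arguments.
Unset Strict Implicit.
Unset Printing Implicit Defensive.
Import Order.TTheory GRing.Theory Num.Theory.
Import numFieldNormedType.Exports.

Local Open Scope classical_set_scope.
Local Open Scope ring_scope.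
Local Open Scope ereal_scope.

Section tv_dist.
Context d (T : measurableType d) (R : realType).

Definition tv_dist (mu nu : set T -> \bar R) : \bar R :=
  ereal_sup [set `|mu A - nu A| | A in measurable].

End tv_dist.

Section kernel_chain.
Context d (T : measurableType d) (R : realType).
Variable K : R.-pker T ~> T.

(* The values are probability kernels; the composition of kernels available in
   the library is only packaged up to subprobability kernels. *)
Fixpoint kernel_iter (n : nat) : R.-spker T ~> T :=
  if n is m.+1 then mkcomp_noparam (kernel_iter m) K
  else kdirac (@measurable_id _ T setT).

Definition stationary (pi : probability T R) : Prop :=
  forall A, measurable A -> \int[pi]_x K x A = pi A.

Definition ergodic (pi : probability T R) : Prop :=
  stationary pi /\
  {ae pi, forall x, tv_dist (kernel_iter n x) pi @[n --> \oo] --> 0}.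

(* The second clause says that P(X_(n+1) \in A | X_0, ..., X_n) = K (X_n) A
   almost surely, E ranging over the sigma-algebra generated by X_0, ..., X_n. *)
Definition markov_chain (mu : {measure set T -> \bar R})
    d' (Omega : measurableType d') (P : probability Omega R)
    (X : nat -> {RV P >-> T}) : Prop :=
  (forall A, measurable A -> distribution P (X 0%N) A = mu A) /\
  forall (n : nat) (E : set Omega) (A : set T),
    g_sigma_preimage (fun i : 'I_n.+1 => X i : Omega -> T) E -> measurable A ->
    P (E `&` X n.+1 @^-1` A) = \int[P]_(w in E) K (X n w) A.

End kernel_chain.

Definition ergodic_avg (Omega T : Type) (R : realType) (h : T -> R)
    (X : nat -> Omega -> T) (n : nat) (w : Omega) : R :=
  (n%:R^-1 * \sum_(1 <= i < n.+1) h (X i w))%R.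

(* Main.v *)
Require Import Defs.
From HB Require Import structures.
From mathcomp Require Import all_boot all_order all_algebra.
From mathcomp Require Import all_classical all_reals all_analysis.
From mathcomp Require Import measurable_realfun lra.

(** Total variation mixing lets the chain started at x be replaced, from time k
on, by the stationary chain, and the first k steps are invisible at the scale
n^-r.

Fix k, write e_n as the sum of a head (1/n) sum_(i <= k) h(X_i) and of a block
(1/n) sum_(k < i <= n) h(X_i), and put delta_n = (c/2) n^-r.  As r < 1 one has
n delta_n --> +oo, while sum_(i <= k) h(X_i) is a fixed finite random variable;
so the head exceeds delta_n in absolute value with probability tending to 0,
whatever the initial law [near_head_le].  Hence in either chain the
average e_n may be traded for the block, in either direction, at the cost of
widening the interval by delta_n on each side and of a vanishing probability
[measure_perturb]; two such trades use up the margin c n^-r.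

By the Markov property the law of the block is the integral of a [0, 1]-valued
function of X_k that depends only on the kernel [markov_block_prob].  The
law of X_k is pi for the stationary chain and K^k(x, .) for the other one, so
the block probabilities differ by at most || K^k(x, .) - pi ||
[block_prob_le_tv_dist].  Altogether, for every x at which the chain
converges,

  P_pi(a_n < pi(h) - e_n < b_n)
    <= P_x(a_n - c n^-r < pi(h) - e_n < b_n + c n^-r)
       + || K^k(x, .) - pi || + o(1),

and it remains to let n, then k, tend to infinity. *)

Set Implicit Arguments.
Unset Strict Implicit.
Unset Printing Implicit Defensive.
Import Order.TTheory GRing.Theory Num.Theory.
Import numFieldNormedType.Exports.

Local Open Scope classical_set_scope.
Local Open Scope ring_scope.

(** * Conditional laws given by a kernel *)

Section kernel_reindex.
Context d d1 d2 (X : measurableType d) (Y : measurableType d1)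
  (Z : measurableType d2) (R : realType).
Variables (f : X -> Y) (mf : measurable_fun [set: X] f) (k : R.-pker Y ~> Z).

(** The measurability proof is an argument so that the kernel structures can be
inferred from the term. *)
Definition kernel_reindex of measurable_fun [set: X] f :
  X -> {measure set Z -> \bar R} := k \o f.

Let measurable_kernel_reindex U : measurable U ->
  measurable_fun [set: X] (kernel_reindex mf ^~ U).
Proof.
by move=> mU; exact: (measurableT_comp (measurable_kernel k U mU) mf).
Qed.

HB.instance Definition _ := isKernel.Build _ _ _ _ _ (kernel_reindex mf)
  measurable_kernel_reindex.

Let kernel_reindex_prob x : kernel_reindex mf x [set: Z] = 1%E.
Proof. exact: prob_kernel. Qed.

HB.instance Definition _ := Kernel_isProbability.Build _ _ _ _ _
  (kernel_reindex mf) kernel_reindex_prob.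

End kernel_reindex.

(** Rectangles form a pi-system that generates the product sigma-algebra. *)
Lemma measure_prod_unique d1 d2 (T1 : measurableType d1)
    (T2 : measurableType d2) (R : realType)
    (m1 m2 : {measure set (T1 * T2) -> \bar R}) :
    (m1 [set: T1 * T2] < +oo)%E ->
    (forall A B, measurable A -> measurable B ->
      m1 (A `*` B) = m2 (A `*` B)) ->
  forall D, measurable D -> m1 D = m2 D.
Proof.
move=> m1oo m12; apply: (measure_unique
    [set A `*` B | A in measurable & B in measurable] (fun=> setT)) => //.
- exact: measurable_prod_measurableType.
- move=> _ _ [A1 mA1 [B1 mB1 <-]] [A2 mA2 [B2 mB2 <-]].
  rewrite -setXI; exists (A1 `&` A2); first exact: measurableI.
  by exists (B1 `&` B2) => //; exact: measurableI.
- by move=> _; exists setT => //; exists setT => //; rewrite setXTT.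
- by apply/seteqP; split => // x _; exists 0%N.
- by move=> _ [A mA [B mB <-]]; exact: m12.
Qed.

Section one_step.
Local Open Scope ereal_scope.
Context d d1 d2 (Omega : measurableType d) (S : measurableType d1)
  (T : measurableType d2) (R : realType).
Variables (P : probability Omega R) (k : R.-pker Omega ~> T).
Variables (W : Omega -> S) (Y : Omega -> T).
Hypotheses (mW : measurable_fun [set: Omega] W)
  (mY : measurable_fun [set: Omega] Y).
Hypothesis kWY : forall A B, measurable A -> measurable B ->
  P (W @^-1` A `&` Y @^-1` B) = \int[P]_(w in W @^-1` A) k w B.

(** The hypothesis kWY amounts to the equality on rectangles of two measures on
S * T, namely the law of (W, Y) and the law of (W w, y) when w is drawn from P
and then y from k w; hence these measures are equal, and the conclusion follows
by integrating phi against both. *)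
Lemma integral_conditional_law (phi : S * T -> \bar R) :
    (forall z, 0 <= phi z) -> measurable_fun [set: S * T] phi ->
  \int[P]_w phi (W w, Y w) = \int[P]_w \int[k w]_y phi (W w, y).
Proof.
move=> phi0 mphi.
(* The second measure is built as a composite of kernels starting from a point,
   so that its integrals are iterated integrals by integral_kcomp. *)
pose Pk : R.-pker unit ~> Omega :=
  kprobability (measurable_cst (P : pprobability Omega R)).
pose k1 : R.-pker (unit * Omega) ~> T :=
  kernel_reindex k (@measurable_snd _ _ unit Omega).
have mg : measurable_fun [set: unit * Omega * T]
    (fun z : unit * Omega * T => (W z.1.2, z.2)).
  apply: measurable_fun_pair => //.
  apply: (measurableT_comp mW).
  exact: (measurableT_comp measurable_snd measurable_fst).
pose k2 : R.-pker (unit * Omega * T) ~> (S * T)%type := kdirac mg.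
pose k12 : R.-sfker (unit * Omega) ~> (S * T)%type := mkcomp k1 k2.
have k12E u w f : (forall z, 0 <= f z) -> measurable_fun [set: S * T] f ->
    \int[k12 (u, w)]_z f z = \int[k w]_y f (W w, y).
  move=> f0 mf; rewrite [LHS](integral_kcomp k1 k2)//.
  apply: eq_integral => y _; rewrite [LHS]integral_dirac//.
  by rewrite diracT mul1e.
have mWY : measurable_fun [set: Omega] (fun w => (W w, Y w)).
  exact: measurable_fun_pair.
pose law := distribution P (mfun_Sub (mem_set mWY)).
have lawE D : measurable D -> law D = mkcomp Pk k12 tt D.
  apply: measure_prod_unique => [|A B mA mB].
    exact: (le_lt_trans (probability_le1 _ measurableT) (ltry 1)).
  transitivity (P (W @^-1` A `&` Y @^-1` B)); first by [].
  rewrite kWY// integral_mkcond; apply: eq_integral => w _.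
  transitivity (\int[k12 (tt, w)]_z (\1_(A `*` B) z)%:E); last first.
    by rewrite integral_indic// ?setIT//; exact: measurableX.
  rewrite k12E//; last first.
    by apply/measurable_EFinP; apply: measurable_indic; exact: measurableX.
  have AB y : (\1_(A `*` B) (W w, y) = \1_A (W w) * \1_B y :> R)%R.
    by rewrite !indicE in_setX/=; case: (_ \in _); case: (_ \in _);
       rewrite ?(mulr0, mul0r, mulr1).
  under eq_integral do rewrite AB EFinM.
  rewrite ge0_integralZl//; last by apply/measurable_EFinP.
  rewrite integral_indic// setIT patchE indicE.
  have -> : (w \in W @^-1` A) = (W w \in A) by [].
  by case: ifP; rewrite ?mul1e ?mul0e.
transitivity (\int[law]_z phi z).
  by rewrite ge0_integral_distribution.
rewrite (eq_measure_integral (mkcomp Pk k12 tt)); last first.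
  by move=> D mD _; exact: lawE.
rewrite [LHS](integral_kcomp Pk k12)//.
by apply: eq_integral => w _; rewrite k12E.
Qed.

End one_step.

(** * Sums along a Markov chain *)

Section chain_law.
Local Open Scope ereal_scope.
Context d (T : measurableType d) (R : realType) (K : R.-pker T ~> T).
Variables (mu : {measure set T -> \bar R}).
Context d' (Omega : measurableType d') (P : probability Omega R).
Variable X : nat -> {RV P >-> T}.
Hypothesis X_chain : markov_chain K mu X.

(** The Markov property for functions of X_(n+1) and of a variable W of the past:
the events W^-1(A) belong to the sigma-algebra of X_0, ..., X_n, where
conditioning on the past gives X_(n+1) the law K (X_n). *)
Lemma markov_integral_step dS (S : measurableType dS) (n : nat)
    (W : Omega -> S) (phi : S * T -> \bar R) :
    measurable_fun [set: Omega] W ->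
    (forall A, measurable A ->
      g_sigma_preimage (fun i : 'I_n.+1 => X i : Omega -> T) (W @^-1` A)) ->
    (forall z, 0 <= phi z) -> measurable_fun [set: S * T] phi ->
  \int[P]_w phi (W w, X n.+1 w) = \int[P]_w \int[K (X n w)]_y phi (W w, y).
Proof.
move=> mW past_W phi0 mphi.
have mXn : measurable_fun [set: Omega] (X n) by [].
rewrite (@integral_conditional_law _ _ _ _ _ _ _ P (kernel_reindex K mXn))//.
by move=> A B mA mB; rewrite (proj2 X_chain)//; exact: past_W.
Qed.

Lemma past_sum (h : T -> R) (k n : nat) (A : set R) :
    measurable_fun [set: T] h -> measurable A ->
  g_sigma_preimage (fun i : 'I_n.+1 => X i : Omega -> T)
    ((fun w => \sum_(k.+1 <= i < n.+1) h (X i w))%R @^-1` A).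
Proof.
move=> mh mA.
pose past := \big[setU/set0]_(i < n.+1)
  preimage_set_system [set: Omega] (X i : Omega -> T) measurable.
have mX i : (i <= n)%N ->
    measurable_fun [set: g_sigma_algebraType past] (X i : Omega -> T).
  move=> le_in _ B mB; apply: sub_sigma_algebra.
  rewrite /past (bigD1 (Ordinal (le_in : (i < n.+1)%N)))//=; left.
  by exists B.
(* The truncation at n makes every term measurable with respect to the past;
   the terms of the sum are not affected. *)
pose g i : g_sigma_algebraType past -> R :=
  if (i <= n)%N then h \o (X i : Omega -> T) else cst 0%R.
have mg i : measurable_fun [set: g_sigma_algebraType past] (g i).
  rewrite /g; case: ifP => // le_in.
  exact: (measurableT_comp mh (mX _ le_in)).
have := measurable_sum (index_iota k.+1 n.+1) mg.
move=> /(_ measurableT A mA); rewrite setTI.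
congr (<<s past >> _); apply/funext => w /=; congr (A _).
apply: eq_big_nat => i /andP[_]; rewrite ltnS /g => le_in.
by rewrite le_in.
Qed.

End chain_law.

Section sums.
Local Open Scope ereal_scope.
Context d (T : measurableType d) (R : realType) (K : R.-pker T ~> T).
Variables (h : T -> R) (B : set R).

(** sum_prob m (s, y) is the probability that s + h(X_1) + ... + h(X_m) lies
in B for the chain started at X_0 = y, computed by conditioning on X_1.  The
accumulated sum s is part of the state so that the recursion closes. *)
Fixpoint sum_prob (m : nat) (z : R * T) : \bar R :=
  if m is m'.+1 then \int[K z.2]_y sum_prob m' ((z.1 + h y)%R, y)
  else (\1_B z.1)%:E.

Hypotheses (mh : measurable_fun [set: T] h) (mB : measurable B).

Lemma sum_prob_ge0 m z : 0 <= sum_prob m z.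
Proof.
elim: m z => [|m IH] z /=; first by rewrite lee_fin.
by apply: integral_ge0 => y _; exact: IH.
Qed.

Let measurable_shift :
  measurable_fun [set: R * T * T]
    (fun z : R * T * T => ((z.1.1 + h z.2)%R, z.2)).
Proof.
apply: measurable_fun_pair => //; apply: measurable_funD.
  exact: (measurableT_comp measurable_fst measurable_fst).
exact: (measurableT_comp mh).
Qed.

Lemma measurable_sum_prob m : measurable_fun [set: R * T] (sum_prob m).
Proof.
elim: m => [|m IH] /=.
  apply/measurable_EFinP.
  exact: (measurableT_comp (measurable_indic mB) measurable_fst).
apply: (measurable_fun_integral_finite_kernel
  (fun z : R * T * T => sum_prob m ((z.1.1 + h z.2)%R, z.2))
  (kernel_reindex K (@measurable_snd _ _ R T))).
- by move=> z; exact: sum_prob_ge0.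
- exact: (measurableT_comp IH measurable_shift).
Qed.

Lemma sum_prob_le1 m z : sum_prob m z <= 1.
Proof.
elim: m z => [|m IH] z /=; first by rewrite lee_fin indicE; case: (_ \in _).
have mS : measurable_fun [set: T] (fun y => sum_prob m ((z.1 + h y)%R, y)).
  apply: (measurableT_comp (measurable_sum_prob m)).
  by apply: measurable_fun_pair => //; exact: measurable_funD.
apply: (@le_trans _ _ (\int[K z.2]_y cst 1 y)).
  apply: ge0_le_integral => //=.
  by move=> y _; exact: sum_prob_ge0.
by rewrite integral_cst// mul1e prob_kernel.
Qed.

Context d' (Omega : measurableType d') (P : probability Omega R).
Variables (mu : {measure set T -> \bar R}) (X : nat -> {RV P >-> T}).
Hypothesis X_chain : markov_chain K mu X.

Let partial_sum k n w : R := (\sum_(k.+1 <= i < n.+1) h (X i w))%R.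

Let measurable_partial_sum k n : measurable_fun [set: Omega] (partial_sum k n).
Proof. by apply: measurable_sum => i; exact: measurableT_comp. Qed.

(** The integral on the right does not depend on how the block is cut at time n:
one Markov step moves the term i = n + 1 from the future, which sum_prob
handles, to the accumulated sum. *)
Lemma markov_sum_prob k n m : (k <= n)%N ->
  P [set w | B (\sum_(k.+1 <= i < (n + m).+1) h (X i w))%R] =
  \int[P]_w sum_prob m ((\sum_(k.+1 <= i < n.+1) h (X i w))%R, X n w).
Proof.
elim: m n => [|m IH] n kn.
  rewrite addn0 /= integral_indic ?setIT//.
  have := measurable_partial_sum k n measurableT mB; rewrite setTI.
  exact.
rewrite addnS -addSn IH ?leqW//=.
pose phi (z : R * T) := sum_prob m ((z.1 + h z.2)%R, z.2).
transitivity (\int[P]_w phi (partial_sum k n w, X n.+1 w)).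
  by apply: eq_integral => w _; rewrite big_nat_recr.
rewrite (markov_integral_step X_chain)//.
- by move=> A mA; exact: past_sum.
- by move=> z; exact: sum_prob_ge0.
- apply: (measurableT_comp (measurable_sum_prob m)).
  apply: measurable_fun_pair => //; apply: measurable_funD => //.
  exact: (measurableT_comp mh).
Qed.

(** Only the law of X_k depends on the initial distribution: this is what allows
two chains with the same kernel to be compared. *)
Lemma markov_block_prob k m :
  P [set w | B (\sum_(k.+1 <= i < (k + m).+1) h (X i w))%R] =
  \int[distribution P (X k)]_y sum_prob m (0%R, y).
Proof.
rewrite markov_sum_prob// ge0_integral_distribution.
- by apply: eq_integral => w _ /=; rewrite big_geq.
- apply: (measurableT_comp (measurable_sum_prob m)).
  exact: measurable_fun_pair.
- by move=> y; exact: sum_prob_ge0.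
Qed.

End sums.

Section marginals.
Local Open Scope ereal_scope.
Context d (T : measurableType d) (R : realType) (K : R.-pker T ~> T).
Context d' (Omega : measurableType d') (P : probability Omega R).
Variable X : nat -> {RV P >-> T}.

Lemma markov_distributionS (mu : {measure set T -> \bar R}) n A :
    markov_chain K mu X -> measurable A ->
  distribution P (X n.+1) A = \int[distribution P (X n)]_y K y A.
Proof.
move=> X_chain mA; rewrite ge0_integral_distribution//; last first.
  exact: measurable_kernel.
have := X_chain.2 n setT A; rewrite setTI; apply => //.
exact: (@measurableT _ (g_sigma_algebraType _)).
Qed.

Lemma markov_distribution_iter x n A : markov_chain K \d_x X -> measurable A ->
  distribution P (X n) A = kernel_iter K n x A.
Proof.
move=> X_chain; elim: n A => [|n IH] A mA; first exact: X_chain.1.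
rewrite (markov_distributionS _ X_chain)//=.
by apply: eq_measure_integral => B mB _; exact: IH.
Qed.

Lemma markov_distribution_stationary (pi : probability T R) n A :
    stationary K pi -> markov_chain K pi X -> measurable A ->
  distribution P (X n) A = pi A.
Proof.
move=> Kpi X_chain; elim: n A => [|n IH] A mA; first exact: X_chain.1.
rewrite (markov_distributionS _ X_chain)// -[RHS]Kpi//.
by apply: eq_measure_integral => B mB _; exact: IH.
Qed.

End marginals.

(** * Total variation distance *)

Section total_variation.
Local Open Scope ereal_scope.
Context d (T : measurableType d) (R : realType).

Lemma eq_tv_dist (mu mu' nu : set T -> \bar R) :
    (forall A, measurable A -> mu A = mu' A) ->
  tv_dist mu nu = tv_dist mu' nu.
Proof.
move=> mumu'; congr ereal_sup; apply/seteqP.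
by split=> _ [A mA <-]; exists A => //; rewrite mumu'.
Qed.

Lemma tv_dist_ge0 (mu nu : set T -> \bar R) : 0 <= tv_dist mu nu.
Proof.
apply: (@le_trans _ _ `|mu set0 - nu set0|); first exact: abse_ge0.
by apply: ereal_sup_ubound; exists set0.
Qed.

Lemma measure_le_tv_dist (mu nu : probability T R) A : measurable A ->
  nu A <= mu A + tv_dist mu nu.
Proof.
move=> mA; rewrite -leeBlDl ?fin_num_measure//.
apply: (@le_trans _ _ `|mu A - nu A|); last first.
  by apply: ereal_sup_ubound; exists A.
by rewrite -abseN fin_num_oppeB ?fin_num_measure// addeC; exact: lee_abs.
Qed.

(** By the tail formula the integral of f is the integral over r in [0, 1] of
the measure of {f > r}, and for each r the two measures of this set differ by
at most the total variation distance. *)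
Lemma integral_le_tv_dist (mu nu : probability T R) (f : T -> R) :
    measurable_fun [set: T] f -> (forall x, 0 <= f x <= 1)%R ->
  \int[nu]_x (f x)%:E <= \int[mu]_x (f x)%:E + tv_dist mu nu.
Proof.
move=> mf f01.
pose F : {mfun T >-> R} := mfun_Sub (mem_set mf).
have tail (rho : probability T R) :
    \int[rho]_x (f x)%:E =
    \int[lebesgue_measure]_(r in `[0%R, +oo[) rho [set x | (r < f x)%R].
  transitivity ('E_rho[F]); first by rewrite expectation_def.
  rewrite (@ge0_expectation_ccdf _ _ _ rho F); last first.
    by move=> x /=; have /andP[] := f01 x.
  apply: eq_integral => r _; rewrite /ccdf /distribution /pushforward.
  by congr (rho _); apply/seteqP; split => x /=; rewrite in_itv/= andbT.
have mtail r : measurable [set x | (r < f x)%R].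
  have := mf measurableT `]r, +oo[%classic (measurable_itv _).
  by rewrite setTI set_itvoy.
have mtails (rho : probability T R) :
    measurable_fun [set: R] (fun r => rho [set x | (r < f x)%R]).
  have := ccdf_measurable (F : {RV rho >-> R}); apply: eq_measurable_fun => r _.
  rewrite /ccdf /distribution /pushforward.
  by congr (rho _); apply/seteqP; split => x /=; rewrite in_itv/= andbT.
have m01 : measurable_fun [set: R]
    (fun r => (\1_`[0%R, 1%R] r)%:E : \bar R).
  by apply/measurable_EFinP; exact: measurable_indic.
have l01 : lebesgue_measure (`[0%R, 1%R]%classic : set R) = 1.
  by rewrite lebesgue_measure_itv/= lte_fin ltr01 oppr0 adde0.
rewrite !tail.
have -> : tv_dist mu nu = \int[lebesgue_measure]_(r in `[0%R, +oo[)
    (tv_dist mu nu * (\1_(`[0%R, 1%R] : set R) r)%:E).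
  rewrite ge0_integralZl//; last 2 first.
  - exact: measurable_funTS.
  - exact: tv_dist_ge0.
  rewrite integral_indic// setIidl; last exact: subset_itvl.
  by rewrite [X in _ * X]l01 mule1.
rewrite -ge0_integralD//; last 3 first.
- by apply: measurable_funTS; exact: mtails.
- by move=> r _; rewrite mule_ge0// ?lee_fin// tv_dist_ge0.
- by apply: measurable_funTS; exact: emeasurable_funM.
apply: ge0_le_integral => //.
- by apply: measurable_funTS; exact: mtails.
- apply: measurable_funTS; apply: emeasurable_funD.
    exact: mtails.
  exact: emeasurable_funM.
move=> r /=; rewrite in_itv/= andbT => r0.
have [r1|r1] := leP r 1%R.
  rewrite indicE mem_set ?mule1; last by rewrite /= in_itv/= r0 r1.
  exact: measure_le_tv_dist.
rewrite (_ : [set x | _] = set0) ?measure0; last first.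
  apply/seteqP; split => // x /= rfx.
  by have := lt_trans r1 rfx; rewrite ltNge; have /andP[_ ->] := f01 x.
by rewrite add0e mule_ge0// ?lee_fin// tv_dist_ge0.
Qed.

End total_variation.

(** * Comparison of two chains with the same kernel *)

Section coupling.
Local Open Scope ereal_scope.
Context d (T : measurableType d) (R : realType) (K : R.-pker T ~> T).
Variables (pi : probability T R) (h : T -> R).
Hypotheses (Kpi : stationary K pi) (mh : measurable_fun [set: T] h).
Context d0 (Omega0 : measurableType d0) (P0 : probability Omega0 R).
Context d1 (Omega1 : measurableType d1) (P1 : probability Omega1 R).
Variables (X0 : nat -> {RV P0 >-> T}) (X1 : nat -> {RV P1 >-> T}) (x : T).
Hypotheses (X0_chain : markov_chain K pi X0)
  (X1_chain : markov_chain K \d_x X1).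

(** Both probabilities integrate the same [0, 1]-valued function, one against
pi, which is the law of X_k in the stationary chain, the other against the
k-step kernel at x. *)
Lemma block_prob_le_tv_dist (B : set R) k n : measurable B -> (k <= n)%N ->
  P0 [set w | B (\sum_(k.+1 <= i < n.+1) h (X0 i w))%R] <=
  P1 [set w | B (\sum_(k.+1 <= i < n.+1) h (X1 i w))%R] +
    tv_dist (kernel_iter K k x) pi.
Proof.
move=> mB /subnKC <-.
rewrite (markov_block_prob mh mB X0_chain).
rewrite (markov_block_prob mh mB X1_chain).
set g := fun y => sum_prob K h B (n - k) (0%R, y).
have g_fin y : (g y) \is a fin_num.
  rewrite ge0_fin_numE; last exact: sum_prob_ge0.
  by rewrite (le_lt_trans (sum_prob_le1 _ mh mB _ _))// ltry.
have gE (rho : {measure set T -> \bar R}) :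
    \int[rho]_y g y = \int[rho]_y (fine (g y))%:E.
  by apply: eq_integral => y _; rewrite fineK.
rewrite (eq_measure_integral pi); last first.
  by move=> A mA _; exact: (markov_distribution_stationary _ Kpi X0_chain mA).
rewrite [in leLHS]gE [in leRHS]gE.
rewrite -(@eq_tv_dist _ _ _ (distribution P1 (X1 k))); last first.
  by move=> A mA; exact: (markov_distribution_iter _ X1_chain mA).
apply: integral_le_tv_dist.
- apply: measurableT_comp; first exact: fine_measurable.
  apply: (measurableT_comp (measurable_sum_prob K mh mB (n - k))).
  exact: measurable_fun_pair.
- move=> y; rewrite -!lee_fin fineK// sum_prob_ge0.
  exact: (sum_prob_le1 _ mh mB).
Qed.

End coupling.

(** * Limits and perturbations *)

Lemma limn_einf_le_near (R : realType) (u v : (\bar R)^nat) :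
    (forall e : R, (0 < e)%R -> \forall n \near \oo, (u n <= v n + e%:E)%E) ->
  (limn_einf u <= limn_einf v)%E.
Proof.
move=> uv; apply/lee_addgt0Pr => e e0.
rewrite addeC -limn_einf_shift// !limn_einf_lim.
apply: lee_lim; [exact: is_cvg_einfs|exact: is_cvg_einfs|].
have [N _ uvN] := uv e e0; exists N => // n /= Nn.
apply: le_ereal_inf_tmp => _ [k /= nk <-].
rewrite addeC (le_trans _ (uvN k _))//=; last exact: leq_trans nk.
by apply: ereal_inf_lbound; exists k.
Qed.

Lemma near_tail_le (R : realType) d (Omega : measurableType d)
    (P : probability Omega R) (Z : Omega -> R) (t : R^nat) (e : R) :
    measurable_fun [set: Omega] Z -> t @ \oo --> +oo%R -> 0 < e ->
  \forall n \near \oo, (P [set w | (t n < `|Z w|)%R] <= e%:E)%E.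
Proof.
move=> mZ t_oo e0.
have mZn : measurable_fun [set: Omega] (fun w => `|Z w|).
  exact: measurableT_comp.
pose Y : {RV P >-> R} := mfun_Sub (mem_set mZn).
have ccdfE r : ccdf Y r = P [set w | r < `|Z w|].
  rewrite /ccdf /distribution /pushforward.
  by congr (P _); apply/seteqP; split => w /=; rewrite in_itv/= andbT.
have /fine_cvgP[_ /cvgrPdist_le/(_ e e0) tail] :=
  cvg_comp _ _ t_oo (cvg_ccdfy0 Y).
near=> n; rewrite -ccdfE -[leLHS]fineK ?fin_num_measure// lee_fin.
have : `|0 - fine (ccdf Y (t n))| <= e by near: n; exact: tail.
by rewrite sub0r normrN; apply: le_trans; exact: ler_norm.
Unshelve. all: by end_near. Qed.

Lemma cvg_natr_mul_powRN (R : realType) (c r : R) : 0 < c -> r < 1 ->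
  n%:R * (c * n%:R `^ (- r)) @[n --> \oo] --> +oo%R.
Proof.
move=> c0 r1; apply/cvgryPge => M.
have r1' : 0 < 1 - r by rewrite subr_gt0.
pose A := Num.max 0 (M / c).
have A0 : 0 <= A by rewrite le_max lexx.
near=> n.
have n0 : 0 < n%:R :> R by rewrite ltr0n; near: n; exact: nbhs_infty_gt.
rewrite mulrCA -[X in c * (X * _)]powRr1 ?(ltW n0)// -powRD; last first.
  by rewrite gt_eqF// implybT.
rewrite -ler_pdivrMl// mulrC (@le_trans _ _ A)//.
  by rewrite le_max lexx orbT.
rewrite [leLHS](_ : _ = A `^ (1 - r)^-1 `^ (1 - r)); last first.
  by rewrite -powRrM mulVf ?gt_eqF// powRr1.
apply: ge0_ler_powR; rewrite ?nnegrE ?powR_ge0 ?(ltW n0) ?(ltW r1')//.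
by near: n; exact: nbhs_infty_ger.
Unshelve. all: by end_near. Qed.

(** Serves both to pass from the average to the block in the stationary chain and
to return from the block to the average in the chain started at x. *)
Lemma measure_perturb (R : realType) d (Omega : measurableType d)
    (P : probability Omega R) (U V : Omega -> R) (a b l e : R) :
    measurable_fun [set: Omega] U -> measurable_fun [set: Omega] V ->
  (P [set w | (a < l - U w < b)%R] <=
   P [set w | (a - e < l - V w < b + e)%R] +
     P [set w | (e < `|U w - V w|)%R])%E.
Proof.
have mI (Z : Omega -> R) (p q : R) : measurable_fun [set: Omega] Z ->
    measurable [set w | p < l - Z w < q].
  move=> mZ.
  have mlZ : measurable_fun [set: Omega] (fun w => l - Z w).
    exact: measurable_funB.
  have := mlZ measurableT `]p, q[%classic (measurable_itv _).
  by rewrite setTI set_itvoo.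
move=> mU mV.
have mE : measurable [set w | e < `|U w - V w|].
  have mN : measurable_fun [set: Omega] (fun w => `|U w - V w|).
    by apply: measurableT_comp => //; exact: measurable_funB.
  have := mN measurableT `]e, +oo[%classic (measurable_itv _).
  by rewrite setTI set_itvoy.
apply: le_trans (measureU2 _ (mI _ _ _ mV) mE).
apply: le_measure; rewrite ?inE.
- exact: mI.
- by apply: measurableU => //; exact: mI.
- move=> w /= abU; have [eUV|UVe] := ltP e `|U w - V w|; first by right.
  left; move: UVe; rewrite ler_norml => /andP[? ?].
  by move: abU => /andP[? ?]; apply/andP; split; lra.
Qed.

Section averages.
Context d (T : measurableType d) (R : realType).
Variables (h : T -> R) (mh : measurable_fun [set: T] h).
Context d' (Omega : measurableType d') (P : probability Omega R).
Variable X : nat -> {RV P >-> T}.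

Definition block_avg (k n : nat) (w : Omega) : R :=
  n%:R^-1 * \sum_(k.+1 <= i < n.+1) h (X i w).

Lemma measurable_block_avg k n : measurable_fun [set: Omega] (block_avg k n).
Proof.
apply: measurable_funM => //; apply: measurable_sum => i.
exact: measurableT_comp.
Qed.

(** The difference is the sum of the first k terms divided by n, and the
threshold n c n^-r that this fixed sum must exceed tends to infinity. *)
Lemma near_head_le (c r e : R) (k : nat) : 0 < c -> r < 1 -> 0 < e ->
  \forall n \near \oo, (P [set w |
    (c * n%:R `^ (- r) < `|ergodic_avg h X n w - block_avg k n w|)%R] <=
    e%:E)%E.
Proof.
move=> c0 r1 e0.
pose Z w := \sum_(1 <= i < k.+1) h (X i w).
have mZ : measurable_fun [set: Omega] Z.
  by apply: measurable_sum => i; exact: measurableT_comp.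
near=> n.
have n0 : 0 < n%:R :> R by rewrite ltr0n; near: n; exact: nbhs_infty_gt.
have kn : (k <= n)%N by near: n; exact: nbhs_infty_ge.
have -> : [set w | c * n%:R `^ (- r) < `|ergodic_avg h X n w - block_avg k n w|]
    = [set w | n%:R * (c * n%:R `^ (- r)) < `|Z w|].
  apply/funext => w /=; congr is_true.
  rewrite /ergodic_avg /block_avg (big_cat_nat (n := k.+1))//= mulrDr addrK.
  by rewrite normrM gtr0_norm ?invr_gt0// ltr_pdivlMl.
near: n; apply: near_tail_le => //; exact: cvg_natr_mul_powRN.
Unshelve. all: by end_near. Qed.

End averages.

Theorem theorem5 (R : realType) (d : measure_display) (T : measurableType d)
    (K : R.-pker T ~> T) (pi : probability T R) (Kpi : ergodic K pi)
    (h : T -> R) (mh : measurable_fun [set: T] h)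
    (ih : pi.-integrable [set: T] (EFin \o h))
    (alpha : R) (alpha01 : 0 < alpha < 1) (a b : nat -> R)
    (d0 : measure_display) (Omega0 : measurableType d0)
    (P0 : probability Omega0 R) (X0 : nat -> {RV P0 >-> T})
    (X0_chain : markov_chain K pi X0)
    (cover : ((1 - alpha)%:E <= limn_einf (fun n => P0 [set w |
        (a n < (\int[pi]_x h x) - ergodic_avg h X0 n w < b n)%R]))%E)
    (c r : R) (c0 : 0 < c) (r01 : 0 < r < 1) :
  {ae pi, forall x,
    forall (d1 : measure_display) (Omega1 : measurableType d1)
      (P1 : probability Omega1 R) (X1 : nat -> {RV P1 >-> T}),
    markov_chain K \d_x X1 ->
    ((1 - alpha)%:E <= limn_einf (fun n => P1 [set w |
        (a n - c * n%:R `^ (- r) < (\int[pi]_x h x) - ergodic_avg h X1 n w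
           < b n + c * n%:R `^ (- r))%R]))%E}.
Proof.
case: Kpi => Kpi; apply: filterS => x tv0 d1 Omega1 P1 X1 X1_chain.
have /andP[_ r1] := r01.
apply: (le_trans cover); apply: limn_einf_le_near => e e0.
have c20 : 0 < c / 2 by rewrite divr_gt0.
have e30 : 0 < e / 3 by rewrite divr_gt0.
have [k tvk] : exists k, (tv_dist (kernel_iter K k x) pi <= (e / 3)%:E)%E.
  move/fine_cvgP : tv0 => [fin_tv /cvgrPdist_le/(_ _ e30) near_tv].
  have [N _ /(_ N (leqnn N))[fin_tvN]] := filterI fin_tv near_tv.
  rewrite /= sub0r normrN => le_tvN; exists N.
  by rewrite -[leLHS]fineK// lee_fin (le_trans (ler_norm _)).
near=> n.
have kn : (k <= n)%N by near: n; exact: nbhs_infty_ge.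
set l := \int[pi]_x h x; set t := n%:R `^ (- r).
have m_avg d' (Omega : measurableType d') (P : probability Omega R)
    (X : nat -> {RV P >-> T}) :
    measurable_fun [set: Omega] (ergodic_avg h X n).
  apply: measurable_funM => //; apply: measurable_sum => i.
  exact: measurableT_comp.
have head0 : (P0 [set w | (c / 2 * t <
    `|ergodic_avg h X0 n w - block_avg h X0 k n w|)%R] <= (e / 3)%:E)%E.
  by rewrite /t; near: n; exact: near_head_le.
have head1 : (P1 [set w | (c / 2 * t <
    `|block_avg h X1 k n w - ergodic_avg h X1 n w|)%R] <= (e / 3)%:E)%E.
  under eq_set do rewrite distrC.
  by rewrite /t; near: n; exact: near_head_le.
pose B := [set s : R | a n - c / 2 * t < l - n%:R^-1 * s < b n + c / 2 * t].
have mB : measurable B.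
  have mlin : measurable_fun [set: R] (fun s : R => l - n%:R^-1 * s).
    by apply: measurable_funB => //; exact: measurable_funM.
  have := mlin measurableT _ (measurable_itv
    `](a n - c / 2 * t), (b n + c / 2 * t)[).
  by rewrite setTI set_itvoo.
have stat_block := measure_perturb P0 (a n) (b n) l (c / 2 * t)
  (m_avg _ _ _ X0) (measurable_block_avg mh X0 k n).
have block_avg1 := measure_perturb P1 (a n - c / 2 * t) (b n + c / 2 * t) l
  (c / 2 * t) (measurable_block_avg mh X1 k n) (m_avg _ _ _ X1).
have block := block_prob_le_tv_dist Kpi mh X0_chain X1_chain mB kn.
(* One third of e for each exchange between average and block, and one third for
   the distance between the laws of X_k. *)
have eE : (e%:E = (e / 3)%:E + (e / 3)%:E + (e / 3)%:E)%E.
  by rewrite -!EFinD; congr EFin; lra.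
have -> : a n - c * t = a n - c / 2 * t - c / 2 * t by lra.
have -> : b n + c * t = b n + c / 2 * t + c / 2 * t by lra.
apply: (le_trans stat_block); rewrite eE !addeA.
apply: leeD head0; apply: (le_trans block).
by apply: leeD tvk; apply: (le_trans block_avg1); exact: leeD.
Unshelve. all: by end_near. Qed.
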